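(* Let $P \in \mathbb{Z}[x]$ be a non-constant polynomial with leading coefficient $A$. Let $a, b \in \mathbb{N}$ with $\gcd(a,b) = 1$, and suppose that $$(a/b)^{P(a/b)} \in \mathbb{Q}.$$ If $|A| = 1$ then $b = 1$. Otherwise $$b < 3|A| \log_2 |A|.$$
   Context: $\mathbb{N}$ denotes the set of positive integers. $\log_2$ denotes the logarithm to base $2$. Powers of positive real numbers with real exponents denote the positive real value. *)

(* Defs.v *)
From HB Require Import structures.
From mathcomp Require Import all_boot all_order all_algebra.
From mathcomp Require Import all_classical all_reals all_analysis.
Set Implicit Arguments.
Unset Strict Implicit.
Unset Printing Implicit Defensive.
Import Order.TTheory GRing.Theory Num.Theory.
Local Open Scope ring_scope.

Definition log2 (R : realType) (x : R) : R := ln x / ln 2.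

(* Main.v *)
Require Import Defs.
From HB Require Import structures.
From mathcomp Require Import all_boot all_order all_algebra.
From mathcomp Require Import all_classical all_reals all_analysis.
From mathcomp Require Import zify ring.
Set Implicit Arguments.
Unset Strict Implicit.
Unset Printing Implicit Defensive.
Import Order.TTheory GRing.Theory Num.Theory.
Local Open Scope ring_scope.

(** Write x = a/b in lowest terms and P(x) = m/k in lowest terms.  Two facts
    about k compete.

    - The integer polynomial k P - m vanishes at x and, P being non-constant,
      has leading coefficient k A.  The rational root theorem
      ([denq_root_dvd_lead_coef]) then says that b divides k A, so that
      b <= k |A|: a large b forces a large k.
    - If x^(m/k) is a rational q, then x^m = q^k with m and k coprime, and a
      Bezout relation makes x itself a k-th power of a rational number
      ([rational_powR_denq_exp]).  Hence b = t^k for some integer t, so that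
      b = 1 or 2^k <= b: a large k forces a much larger b.

    If |A| = 1, then t^k <= k, which leaves only t = 1.  If n = |A| >= 2 and
    t >= 2, then 2^k <= k n, and this already implies 2^k < n^3
    ([exp2_lt_cube]), that is, k < 3 log2 n; substituting in b <= k n gives
    the bound.  When b = 1, the same computation goes through with 1 in the
    place of k. *)

(** The rational root theorem, for the denominator: after multiplication of
    P(n/d) = 0 by d^(deg P), every term except the leading one is visibly a
    multiple of d, and n is prime to d. *)
Lemma denq_root_dvd_lead_coef (P : {poly int}) (x : rat) :
  root (map_poly intr P) x -> (denq x %| lead_coef P)%Z.
Proof.
move=> /rootP; have [->|P0] := eqVneq P 0; first by rewrite lead_coef0 dvdz0.
have szP : size P = (size P).-1.+1 by rewrite prednK // lt0n size_poly_eq0.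
rewrite lead_coefE; move: (size P).-1 szP => m szP.
set n := numq x; set d := denq x => Px0.
have d0 : (d%:~R : rat) != 0 by rewrite intr_eq0 denq_eq0.
have hom0 : \sum_(i < m.+1) P`_i * n ^+ i * d ^+ (m - i) = 0.
  apply: (@intr_inj rat); rewrite rmorph_sum /=.
  transitivity (d%:~R ^+ m * (map_poly intr P).[x]); last by rewrite Px0 mulr0.
  rewrite horner_coef size_map_inj_poly ?rmorph0 //; last exact: intr_inj.
  rewrite szP mulr_sumr; apply: eq_bigr => i _.
  rewrite coef_map /= -[in RHS](divq_num_den x) -/n -/d.
  rewrite !rmorphM !rmorphXn /= expr_div_n.
  have -> : (d%:~R : rat) ^+ m = d%:~R ^+ (m - i) * d%:~R ^+ i.
    by rewrite -exprD subnK // -ltnS.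
  have : (d%:~R : rat) ^+ i != 0 by rewrite expf_neq0.
  by move: (_ ^+ i) (_ ^+ (m - i)) => u v u0; field.
have dn : coprimez d (n ^+ m).
  by apply: coprimezXr; rewrite coprimezE coprime_sym coprime_num_den.
rewrite -(Gauss_dvdzl _ dn).
move: hom0; rewrite big_ord_recr /= subnn expr0 mulr1 addrC => /eqP.
rewrite addr_eq0 => /eqP ->; rewrite rpredN rpred_sum // => i _.
apply: dvdz_mull.
by rewrite -(subnSK (ltn_ord i)) exprS dvdz_mulr.
Qed.

(** With u m + v k = 1, one has x = (x^m)^u (x^k)^v = (q^u x^v)^k. *)
Lemma coprime_power_is_power (F : fieldType) (x q : F) (m : int) (k : nat) :
  x != 0 -> coprimez m k -> x ^ m = q ^+ k -> exists s, x = s ^+ k.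
Proof.
move=> x0 /coprimezP [[u v] /= uv] xq; exists (q ^ u * x ^ v).
rewrite exprMn -[x in LHS]expr1z -uv expfzDr //.
by rewrite !exprnP (exprzAC q) -(exprnP q) -xq !exprz_exp (mulrC m).
Qed.

Lemma denqX (s : rat) (k : nat) : denq (s ^+ k) = denq s ^+ k.
Proof.
have d0 : denq s ^+ k != 0 by rewrite expf_neq0 // denq_eq0.
have dge0 : 0 <= denq s ^+ k by rewrite exprn_ge0 // denq_ge0.
have cop : coprime `|numq s ^+ k| `|denq s ^+ k|.
  by rewrite !abszX coprimeXl // coprimeXr // coprime_num_den.
rewrite -[s in LHS]divq_num_den expr_div_n.
rewrite -(rmorphXn intr k (numq s)) -(rmorphXn intr k (denq s)).
by rewrite coprimeq_den // (negPf d0) ger0_norm.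
Qed.

Lemma cube_lt_exp4 (k : nat) : (k ^ 3 < 4 ^ k)%N.
Proof.
case: k => [|[|[|k]]] //.
elim: k => [//|k IH].
rewrite [(4 ^ _)%N]expnS; nia.
Qed.

(** If n^3 <= 2^k <= k n, then n^2 <= k, so 4^k <= k^2 n^2 <= k^3, against
    [cube_lt_exp4].  This replaces a study of the monotonicity of
    t / log2 t by a comparison of natural numbers. *)
Lemma exp2_lt_cube (n k : nat) :
  (0 < n)%N -> (2 ^ k <= k * n)%N -> (2 ^ k < n ^ 3)%N.
Proof.
move=> n0 le; rewrite ltnNge; apply/negP => le3.
have h4 := cube_lt_exp4 k.
have e4 : (4 ^ k = 2 ^ k * 2 ^ k)%N by rewrite -expnMn.
move: (2 ^ k)%N le le3 e4 => X le le3 e4.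
have nk : (n ^ 2 <= k)%N.
  by rewrite -(leq_pmul2r n0) -expnSr (leq_trans le3).
have : (4 ^ k <= k ^ 3)%N.
  rewrite e4 (leq_trans (leq_mul le le)) //.
  have -> : (k * n * (k * n) = k ^ 2 * n ^ 2)%N by rewrite mulnACA !mulnn.
  by rewrite (expnSr k 2) leq_mul.
by rewrite leqNgt h4.
Qed.

Lemma lt_mul_log2 (R : realType) (n k : nat) :
  (0 < n)%N -> (2 ^ k < n ^ 3)%N -> k%:R < 3 * log2 (n%:R : R).
Proof.
move=> n0 lt.
have l2 : 0 < ln (2 : R) by rewrite ln_gt0 // ltr1n.
rewrite /log2 mulrA ltr_pdivlMr // mulr_natl mulr_natl.
rewrite -!lnXn ?ltr0n //.
by rewrite ltr_ln ?posrE ?exprn_gt0 ?ltr0n // -!natrX ltr_nat.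
Qed.

(** Raising x^c = q to the power denq c gives x^(numq c) = q^(denq c), an
    equality of rationals with coprime exponents.  The case c = 0 is no
    exception: its denominator is 1. *)
Lemma rational_powR_denq_exp (R : realType) (x c : rat) :
  0 < x -> rational ((ratr x : R) `^ ratr c) ->
  exists s, x = s ^+ `|denq c|%N.
Proof.
move=> x0 [q _ qE]; set k := `|denq c|%N.
have kE : (k : int) = denq c by rewrite /k gez0_abs // denq_ge0.
apply: (@coprime_power_is_power _ x q (numq c)).
- by rewrite gt_eqF.
- by rewrite kE coprimezE coprime_num_den.
have rx0 : (0 : R) < ratr x by rewrite ltr0q.
apply: (fmorph_inj (@ratr R)); rewrite rmorphXn /= qE fmorphXz.
rewrite -powR_intmul ?ltW // -powR_mulrn ?powR_ge0 // -powRrM; congr (_ `^ _).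
rewrite -[c in RHS]divq_num_den (pmulrn _ k) kE.
rewrite -!(ratr_int R) -rmorphM /= divfK // intr_eq0 denq_eq0 //.
Qed.

Theorem theorem2p8 (R : realType) (P : {poly int}) (A : int) (a b : nat)
    (P_nonconstant : (1 < size P)%N) (P_lead : lead_coef P = A)
    (a_gt0 : (0 < a)%N) (b_gt0 : (0 < b)%N) (coprime_ab : coprime a b)
    (rational_pow : rational
      ((a%:R / b%:R : R) `^ (map_poly intr P).[a%:R / b%:R])) :
  (`|A| = 1 -> b = 1%N) /\
  (`|A| <> 1 -> b%:R < 3 * `|A|%:~R * log2 (`|A|%:~R : R)).
Proof.
pose x : rat := a%:R / b%:R; pose c : rat := (map_poly intr P).[x].
have xE : a%:R / b%:R = ratr x :> R by rewrite fmorph_div !rmorph_nat.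
have cE : (map_poly intr P).[ratr x] = ratr c :> R.
  rewrite -horner_map -map_poly_comp /=; congr (_.[_]).
  by apply: eq_map_poly => z /=; rewrite ratr_int.
have dx : denq x = b.
  by rewrite /x !pmulrn coprimeq_den // eqz_nat gtn_eqF.
have [s xs] : exists s, x = s ^+ `|denq c|%N.
  apply: (@rational_powR_denq_exp R); last by rewrite -cE -xE.
  by rewrite divr_gt0 ?ltr0n.
set k := `|denq c|%N in xs.
have k0 : (0 < k)%N by rewrite absz_gt0 denq_eq0.
have kE : (k : int) = denq c by rewrite /k gez0_abs // denq_ge0.
have [t bt] : exists t, b = (t ^ k)%N.
  exists `|denq s|%N; rewrite -abszX -denqX -xs dx //.
set n := `|A|%N.
have nE : `|A| = n by rewrite abszE.
have n0 : (0 < n)%N.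
  by rewrite absz_gt0 -P_lead lead_coef_eq0 -size_poly_gt0 ltnW.
have b_dvd : (b %| k * n)%N.
  (* Q = k P - numq c vanishes at x, since P(x) = c = numq c / k. *)
  pose Q := k%:Z *: P - (numq c)%:P.
  have kz : k%:Z != 0 by rewrite eqz_nat gtn_eqF.
  have Qx : root (map_poly intr Q) x.
    apply/rootP; rewrite rmorphB /= map_polyZ map_polyC /= hornerD hornerN.
    rewrite hornerZ hornerC -/c kE -[c in X in _ * X]divq_num_den.
    by rewrite mulrC divfK ?subrr // intr_eq0 denq_eq0.
  have := denq_root_dvd_lead_coef Qx.
  rewrite dx /Q lead_coefDl; last first.
    rewrite size_polyN size_scale // (leq_ltn_trans (size_polyC_leq1 _)) //.
  by rewrite lead_coefZ P_lead dvdzE abszM.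
have b_le : (b <= k * n)%N by rewrite dvdn_leq // muln_gt0 k0.
split=> [A1|An1].
  have n1 : n = 1%N by apply/eqP; rewrite -eqz_nat -nE A1.
  move: b_gt0 b_le; rewrite bt n1 muln1.
  case: t {bt} => [|[|t]]; rewrite ?exp1n // ?exp0n //.
  by rewrite [(_ <= k)%N]leqNgt ltn_expl.
have n_gt1 : (1 < n)%N.
  rewrite ltn_neqAle n0 andbT eq_sym.
  by apply/eqP => n1; apply: An1; rewrite nE n1.
rewrite nE.
(* The exponent j is k when 2 ^ k <= b, but must be 1 when b = 1: then b = t ^ k
   with t = 1 says nothing about the size of k. *)
have bound j : (b <= j * n)%N -> (2 ^ j <= j * n)%N ->
    b%:R < 3 * n%:R * log2 (n%:R : R).
  move=> bj le; apply: (@le_lt_trans _ _ (j * n)%:R); first by rewrite ler_nat.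
  rewrite natrM mulrAC ltr_pM2r ?ltr0n //.
  by apply: lt_mul_log2 => //; apply: exp2_lt_cube.
have [t_gt1|t_le1] := ltnP 1 t.
  by apply: (bound k) => //; rewrite (leq_trans _ b_le) // bt leq_exp2r.
have b1 : b = 1%N.
  move: b_gt0; rewrite bt.
  by case: t t_le1 {bt} => [|[|]] //; rewrite ?exp0n ?exp1n.
by apply: (bound 1%N); rewrite mul1n // b1.
Qed.
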